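(* Let $f,f^\nu:\mathbb{R}^m\times\mathbb{R}^n\to\overline{\mathbb{R}}$, $\nu\in\mathbb{N}$, be Rockafellians (for functions $\phi,\phi^\nu:\mathbb{R}^n\to\overline{\mathbb{R}}$, respectively), and suppose that $f^\nu$ epi-converges to $f$. Then: (a) If for each $y\in\operatorname{dom}(-\psi)$ there exists $y^\nu\to y$ such that $\{f^\nu_{y^\nu},\nu\in\mathbb{N}\}$ is tight, then $\psi^\nu$ hypo-converges to $\psi$. In fact, for all such $y^\nu\to y$, one has $\psi^\nu(y^\nu)\to\psi(y)$. (b) If $\operatorname{dom}(-\psi)$ has a nonempty interior, $Y$ is a dense subset of $\operatorname{dom}(-\psi)$, and $\{f^\nu_y,\nu\in\mathbb{N}\}$ is tight for each $y\in Y$, then $\psi^\nu$ hypo-converges to $\psi$.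
   Context: $\overline{\mathbb{R}}=[-\infty,\infty]$, $\mathbb{N}=\{1,2,\dots\}$. A function $f:\mathbb{R}^m\times\mathbb{R}^n\to\overline{\mathbb{R}}$ is a Rockafellian for $g:\mathbb{R}^n\to\overline{\mathbb{R}}$ when $f(0,x)=g(x)$ for all $x$. For $y\in\mathbb{R}^m$: $f_y(u,x)=f(u,x)-\langle y,u\rangle$, $f^\nu_y(u,x)=f^\nu(u,x)-\langle y,u\rangle$. Dual functions $\psi,\psi^\nu:\mathbb{R}^m\to\overline{\mathbb{R}}$: $\psi(y)=\inf_{u,x}f_y(u,x)$, $\psi^\nu(y)=\inf_{u,x}f^\nu_y(u,x)$. For a function $g$, $\operatorname{dom} g=\{x\mid g(x)<\infty\}$; thus $\operatorname{dom}(-\psi)=\{y\mid\psi(y)>-\infty\}$. Epi-convergence: $g^\nu:\mathbb{R}^d\to\overline{\mathbb{R}}$ epi-converge to $g:\mathbb{R}^d\to\overline{\mathbb{R}}$ when (i) $\liminf g^\nu(x^\nu)\ge g(x)$ whenever $x^\nu\to x$, and (ii) for every $x$ there is $x^\nu\to x$ with $\limsup g^\nu(x^\nu)\le g(x)$. $g^\nu$ hypo-converges to $g$ when $-g^\nu$ epi-converges to $-g$. Tightness: $\{g^\nu:\mathbb{R}^d\to\overline{\mathbb{R}},\nu\in\mathbb{N}\}$ is tight if for all $\epsilon>0$ there exist a compact set $B_\epsilon\subset\mathbb{R}^d$ and $\nu_\epsilon\in\mathbb{N}$ such that $\inf\{g^\nu(x)\mid x\in B_\epsilon\}\le\inf g^\nu+\epsilon$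 for all $\nu\ge\nu_\epsilon$. *)

(* Defs.v *)
From HB Require Import structures.
From mathcomp Require Import all_boot all_order all_algebra.
From mathcomp Require Import all_classical all_reals all_analysis.

Set Implicit Arguments.
Unset Strict Implicit.
Unset Printing Implicit Defensive.

Import Order.TTheory GRing.Theory Num.Theory.
Import numFieldNormedType.Exports.

Local Open Scope classical_set_scope.
Local Open Scope ring_scope.
Local Open Scope ereal_scope.

Definition dot (R : realType) (m : nat) (y u : 'rV[R]_m) : R :=
  (\sum_(i < m) y ord0 i * u ord0 i)%R.

Definition edom (R : realType) (T : Type) (g : T -> \bar R) : set T :=
  [set x | g x < +oo].

(* Sequences are indexed from 0, as everywhere in the library; epi-convergence
   and tightness depend only on tails, so starting at 1 gives the same notions. *)
Definition epi_converges (R : realType) (T : topologicalType)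
    (g_ : nat -> T -> \bar R) (g : T -> \bar R) : Prop :=
  (forall (x : T) (x_ : nat -> T), x_ @ \oo --> x ->
     g x <= limn_einf (fun k => g_ k (x_ k))) /\
  (forall x : T, exists2 x_ : nat -> T, x_ @ \oo --> x &
     limn_esup (fun k => g_ k (x_ k)) <= g x).

Definition hypo_converges (R : realType) (T : topologicalType)
    (g_ : nat -> T -> \bar R) (g : T -> \bar R) : Prop :=
  epi_converges (fun k x => - g_ k x) (fun x => - g x).

(* B may be empty: the infimum over it is then +oo. *)
Definition tight (R : realType) (T : topologicalType)
    (g_ : nat -> T -> \bar R) : Prop :=
  forall e : R, (0 < e)%R ->
    exists (B : set T) (N : nat), compact B /\
      forall k, (N <= k)%N ->
        ereal_inf (g_ k @` B) <= ereal_inf (range (g_ k)) + e%:E.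

Definition Rockafellian (R : realType) (m n : nat)
    (f : 'rV[R]_m * 'rV[R]_n -> \bar R) (g : 'rV[R]_n -> \bar R) : Prop :=
  forall x, f (0%R, x) = g x.

Definition tilt (R : realType) (m n : nat)
    (f : 'rV[R]_m * 'rV[R]_n -> \bar R) (y : 'rV[R]_m) :
    'rV[R]_m * 'rV[R]_n -> \bar R :=
  fun p => f p - (dot y p.1)%:E.

Definition dual (R : realType) (m n : nat)
    (f : 'rV[R]_m * 'rV[R]_n -> \bar R) (y : 'rV[R]_m) : \bar R :=
  ereal_inf (range (tilt f y)).

(* Main.v *)
Require Import Defs.
From HB Require Import structures.
From mathcomp Require Import all_boot all_order all_algebra.
From mathcomp Require Import all_classical all_reals all_analysis.
From mathcomp Require Import lra.
(* For fixed p = (u, x) the value f_y(p) is affine in y, so psi is concave, and a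
   recovery sequence of each p gives limsup psi^k(y^k) <= psi(y) whenever
   y^k -> y. Conversely, the lower epi-limit condition holds uniformly on compact
   sets, so tightness of the tilted functions along y^k -> y gives
   liminf psi^k(y^k) >= psi(y). In (b), psi is bounded below near an interior
   point z of its domain (a cross-polytope around z is controlled by its finitely
   many vertices), so by concavity psi stays above c < psi(y) on an open set
   around (1 - t) y + t z for small t; this open set meets Y. Hence psi(y) is
   approached by values of psi at points of Y near y, and a diagonal sequence
   yields y^k -> y with liminf psi^k(y^k) >= psi(y). *)

Set Implicit Arguments.
Unset Strict Implicit.

Import Order.TTheory GRing.Theory Num.Theory.
Import numFieldNormedType.Exports.
Local Open Scope classical_set_scope.
Local Open Scope ring_scope.
Local Open Scope ereal_scope.

(** * Limits in the extended reals and selection of sequences *)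

Lemma lte_real_dense (R : realType) (a b : \bar R) : a < b ->
  exists r : R, a < r%:E /\ r%:E < b.
Proof.
case: a b => [a| |] [b| |] //.
- rewrite lte_fin => ab; exists ((a + b) / 2)%R.
  by rewrite !lte_fin !midf_lt.
- by move=> _; exists (a + 1)%R; rewrite lte_fin ltrDl ltr01 ltry.
- by move=> _; exists (b - 1)%R; rewrite lte_fin gtrBl ltr01 ltNyr.
- by move=> _; exists 0%R; rewrite ltNyr ltry.
Qed.

(** Upper and lower limits are used only through strict real thresholds that hold eventually, so
    that infinite values rarely need a separate case. *)
Lemma limn_esup_leP (R : realType) (u : nat -> \bar R) (l : \bar R) :
  limn_esup u <= l <-> forall c : R, l < c%:E -> \forall k \near \oo, u k < c%:E.
Proof.
split=> [ul c lc|H].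
  have /ereal_inf_lt[_ [V Voo <-] Vc] := le_lt_trans ul lc.
  apply: filterS Voo => k Vk; apply: le_lt_trans Vc.
  by apply: ereal_sup_ubound; exists k.
rewrite leNgt; apply/negP => /lte_real_dense[c [lc cu]].
move: cu; rewrite ltNge => /negP; apply; apply: ge_ereal_inf.
exists (ereal_sup (u @` [set k | u k < c%:E])).
  by exists [set k | u k < c%:E] => //; exact: H.
by apply: ge_ereal_sup => _ [k /= kc <-]; exact: ltW.
Qed.

Lemma le_limn_einfP (R : realType) (u : nat -> \bar R) (l : \bar R) :
  l <= limn_einf u <-> forall c : R, c%:E < l -> \forall k \near \oo, c%:E < u k.
Proof.
rewrite /limn_einf leeNr limn_esup_leP; split=> H c lc.
  have := H (- c)%R; rewrite EFinN lteN2 => /(_ lc).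
  by apply: filterS => k; rewrite lteN2.
have := H (- c)%R; rewrite EFinN lteNl => /(_ lc).
by apply: filterS => k; rewrite lteNl.
Qed.

(* A failure of the conclusion yields points s_j at distance < 1/j and indices
   k_j >= j; filling the unused indices with x itself gives a sequence that
   tends to x, because every index is hit only by j <= k_j. *)
Lemma liminf_near (R : realType) (T : pseudoMetricType R)
    (g_ : nat -> T -> \bar R) (g : T -> \bar R) (x : T) (c : R) :
  (forall x_ : nat -> T, x_ @ \oo --> x ->
     g x <= limn_einf (fun k => g_ k (x_ k))) ->
  c%:E < g x -> \forall x' \near x & k \near \oo, c%:E < g_ k x'.
Proof.
move=> gx cg; apply: contrapT => nH.
have /choice[s Hs] : forall j : nat, exists s : nat * T,
    [/\ (j <= s.1)%N, ball x j.+1%:R^-1 s.2 & ~ c%:E < g_ s.1 s.2].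
  move=> j; apply: contrapT => nE; apply: nH.
  exists (ball x j.+1%:R^-1, [set k | (j <= k)%N]) => /=.
    by split; [exact: nbhsx_ballx | exact: nbhs_infty_ge].
  move=> [x' k] /= [xx' jk]; apply: contrapT => ncg.
  by apply: nE; exists (k, x').
have /choice[x_ Hx] : forall k : nat, exists x' : T,
    (x' = x /\ forall j, (s j).1 <> k) \/
    (exists j, (s j).1 = k /\ x' = (s j).2).
  move=> k; have [[j jk]|nj] := pselect (exists j, (s j).1 = k).
    by exists (s j).2; right; exists j.
  by exists x; left; split => // j jk; apply: nj; exists j.
have xx : x_ @ \oo --> x.
  apply/cvg_ballP => e e0.
  have [J _ HJ] := near_infty_natSinv_lt (PosNum e0).
  near=> k.
  case: (Hx k) => [[-> _]|[j [jk ->]]]; first exact: ballxx.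
  have [jJ|Jj] := ltnP j J; last first.
    by case: (Hs j) => _ Hb _; apply: le_ball Hb; apply/ltW/(HJ j).
  have : ((s j).1 <= \max_(i < J) (s i).1)%N.
    exact: (leq_bigmax (Ordinal jJ)).
  rewrite jk leqNgt => /negP; case.
  by near: k; exact: nbhs_infty_gt.
have /le_limn_einfP/(_ c cg)[N _ HN] := gx _ xx.
(* The index [(s N).1] is at least [N] and is hit, though perhaps by some [j] other than [N]; every
   [s j] violates the bound, so any such [j] gives the contradiction. *)
have [Ns _ _] := Hs N.
have := HN _ Ns; case: (Hx (s N).1) => [[_ /(_ N)]//|[j [js ->]]].
by rewrite /= -js; case: (Hs j).
Unshelve. all: by end_near. Qed.

(* x_ k is taken at the largest j <= k whose threshold N j is at most k. *)
Lemma diagonal_sequence (T : Type) (t : T) (P : nat -> nat -> T -> Prop) :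
  (forall i j k x, (i <= j)%N -> P j k x -> P i k x) ->
  (forall j, \forall k \near \oo, exists x, P j k x) ->
  exists x_ : nat -> T, forall j, \forall k \near \oo, P j k (x_ k).
Proof.
move=> Pmono Pex.
have /choice[N HN] : forall j, exists N, forall k, (N <= k)%N -> exists x, P j k x.
  by move=> j; have [N _ HN] := Pex j; exists N => k; exact: HN.
have /choice[x_ Hx] : forall k, exists x,
    forall j, (j <= k)%N -> (N j <= k)%N -> P j k x.
  move=> k; pose Q j := (j <= k)%N && (N j <= k)%N.
  have [[j0 Qj0]|nQ] := pselect (exists j, Q j); last first.
    by exists t => j jk Njk; case: nQ; exists j; apply/andP.
  have Qk j : Q j -> (j <= k)%N by case/andP.
  have exQ : exists j, Q j by exists j0.
  case: (ex_maxnP exQ Qk) => j /andP[jk Njk] jmax.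
  have [x Px] := HN _ _ Njk; exists x => i ik Nik.
  by apply: Pmono Px; apply: jmax; apply/andP.
exists x_ => j; near=> k; apply: Hx; near: k; exact: nbhs_infty_ge.
Unshelve. all: by end_near. Qed.

(** Countably many thresholds stand in for all reals below [l]; they are nondecreasing because
    [diagonal_sequence] asks for nested conditions. *)
Lemma real_approx_below (R : realType) (l : \bar R) : -oo < l ->
  exists a : nat -> R, [/\ {homo a : i j / (i <= j)%N >-> (i <= j)%R},
    forall j, (a j)%:E < l & forall c : R, c%:E < l -> exists j, (c <= a j)%R].
Proof.
case: l => [r _| _|//].
  exists (fun j => r - j.+1%:R^-1)%R; split=> [i j ij|j|c].
  - by rewrite lerD2l lerN2 lef_pV2 ?posrE// ler_nat.
  - by rewrite lte_fin gtrBl invr_gt0.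
  - rewrite lte_fin -subr_gt0 => rc.
    have [J _ HJ] := near_infty_natSinv_lt (PosNum rc).
    by exists J; rewrite lerBrDl -lerBrDr; apply/ltW/(HJ J (leqnn J)).
exists (fun j => j%:R); split=> [i j|j|c _]; first by rewrite ler_nat.
- exact: ltry.
- by exists (Num.truncn `|c|).+1; apply/ltW/(le_lt_trans (ler_norm c))/truncnS_gt.
Qed.

Lemma cvg_ereal_squeeze (R : realType) (u : nat -> \bar R) (l : \bar R) :
  (forall c : R, l < c%:E -> \forall k \near \oo, u k < c%:E) ->
  (forall c : R, c%:E < l -> \forall k \near \oo, c%:E < u k) ->
  u @ \oo --> l.
Proof.
case: l => [r| |] lt_u gt_u.
- have near_r (e : R) : (0 < e)%R ->
      \forall k \near \oo, (r - e)%:E < u k /\ u k < (r + e)%:E.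
    move=> e0; near=> k; split; near: k.
      by apply: gt_u; rewrite lte_fin gtrBl.
    by apply: lt_u; rewrite lte_fin ltrDl.
  apply/fine_cvgP; split.
    by apply: filterS (near_r _ ltr01) => k; case: (u k) => [//||] [].
  apply/cvgrPdist_lt => e /near_r; apply: filterS => k /=.
  by case: (u k) => [x||] [] //; rewrite !lte_fin distrC ltr_distl => -> ->.
- by apply/cvgeyPgt => c; apply: gt_u; exact: ltry.
- by apply/cvgeNyPlt => c; apply: lt_u; exact: ltNyr.
Unshelve. all: by end_near. Qed.

(** * Dual values along convergent sequences of multipliers *)

Lemma cvg_dot (R : realType) (m : nat) (T : Type) (F : set_system T)
    (FF : Filter F) (y_ u_ : T -> 'rV[R]_m) (y u : 'rV[R]_m) :
  y_ @ F --> y -> u_ @ F --> u -> dot (y_ t) (u_ t) @[t --> F] --> dot y u.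
Proof.
move=> yy uu; rewrite /dot; apply: cvg_big => [|i _]; first exact: add_continuous.
apply: cvgM.
  by apply: (cvg_comp y_ (fun v => v ord0 i) yy); exact: coord_continuous.
by apply: (cvg_comp u_ (fun v => v ord0 i) uu); exact: coord_continuous.
Qed.

Lemma lt_tilt (R : realType) (m n : nat) (f : 'rV[R]_m * 'rV[R]_n -> \bar R)
    (y : 'rV[R]_m) p (c : R) :
  (c%:E < tilt f y p) = ((c + dot y p.1)%:E < f p).
Proof. by rewrite /tilt lteBrDr. Qed.

Lemma tilt_lt (R : realType) (m n : nat) (f : 'rV[R]_m * 'rV[R]_n -> \bar R)
    (y : 'rV[R]_m) p (c : R) :
  (tilt f y p < c%:E) = (f p < (c + dot y p.1)%:E).
Proof. by rewrite /tilt lteBlDr. Qed.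

(** Trades a bound on an infimum for an affine minorant of [f]; such minorants are combined by real
    arithmetic. *)
Lemma le_dualP (R : realType) (m n : nat) (f : 'rV[R]_m * 'rV[R]_n -> \bar R)
    (y : 'rV[R]_m) (c : R) :
  c%:E <= dual f y <-> forall p, (c + dot y p.1)%:E <= f p.
Proof.
split=> [cf p|cf].
  rewrite EFinD -leeBrDr//; apply: le_trans cf _.
  by apply: ereal_inf_lbound; exists p.
by apply: le_ereal_inf_tmp => _ [p _ <-]; rewrite /tilt leeBrDr// -EFinD.
Qed.

Lemma dual_lt_near (R : realType) (m n : nat)
    (f_ : nat -> 'rV[R]_m * 'rV[R]_n -> \bar R)
    (f : 'rV[R]_m * 'rV[R]_n -> \bar R) (y_ : nat -> 'rV[R]_m) (y : 'rV[R]_m)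
    (c : R) :
  epi_converges f_ f -> y_ @ \oo --> y -> dual f y < c%:E ->
  \forall k \near \oo, dual (f_ k) (y_ k) < c%:E.
Proof.
move=> [_ f_sup] yy /ereal_inf_lt[_ [p _ <-]].
(* The real [d] splits the gap: the recovery sequence stays below [d], and continuity of the pairing
   keeps [c + dot (y_ k) (p_ k).1] above it. *)
rewrite tilt_lt => /lte_real_dense[d [fd]]; rewrite lte_fin => dc.
have [p_ pp /limn_esup_leP/(_ d fd) f_d] := f_sup p.
have dd : dot (y_ k) (p_ k).1 @[k --> \oo] --> dot y p.1.
  by apply: cvg_dot => //; apply: cvg_comp pp _; exact: cvg_fst.
near=> k; apply: (@le_lt_trans _ _ (tilt (f_ k) (y_ k) (p_ k))).
  by apply: ereal_inf_lbound; exists (p_ k).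
rewrite tilt_lt; apply: (@lt_trans _ _ d%:E); first by near: k.
rewrite lte_fin -ltrBlDl; near: k.
by apply: (cvgr_gt (dot y p.1)) => //; rewrite ltrBlDl.
Unshelve. all: by end_near. Qed.

Lemma tight_dual_gt_near (R : realType) (m n : nat)
    (f_ : nat -> 'rV[R]_m * 'rV[R]_n -> \bar R)
    (f : 'rV[R]_m * 'rV[R]_n -> \bar R) (y_ : nat -> 'rV[R]_m) (y : 'rV[R]_m)
    (c : R) :
  epi_converges f_ f -> y_ @ \oo --> y ->
  tight (fun k => tilt (f_ k) (y_ k)) -> c%:E < dual f y ->
  \forall k \near \oo, c%:E < dual (f_ k) (y_ k).
Proof.
move=> [f_inf _] yy tf /lte_real_dense[b []]; rewrite lte_fin => cb bf.
(* Tightness with this tolerance costs half of the gap between [c] and [b], which leaves the bound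
   [(b + c) / 2 > c]. *)
have e0 : (0 < (b - c) / 2)%R by rewrite divr_gt0// subr_gt0.
have [B [N [/compact_near_coveringP cB HB]]] := tf _ e0.
(* In near-covering form, compactness reduces the uniform bound on [B] to a bound valid jointly for
   points near each [p] and for large [k], which [liminf_near] provides. *)
have Bb : \forall k \near \oo, B `<=` [set p | b%:E < tilt (f_ k) (y_ k) p].
  apply: cB => p Bp.
  have : b%:E < tilt f y p.
    by apply: lt_le_trans bf _; apply: ereal_inf_lbound; exists p.
  rewrite lt_tilt => /lte_real_dense[d []]; rewrite lte_fin => bd df.
  have fd := liminf_near (f_inf p) df.
  have dd : dot (y_ q.2) (q.1).1 @[q --> (nbhs p, \oo)] --> dot y p.1.
    apply: cvg_dot.
      by apply: cvg_comp yy; exact: cvg_snd.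
    by apply: (cvg_comp _ _ cvg_fst); exact: cvg_fst.
  near=> q; rewrite /= lt_tilt; apply: (@lt_trans _ _ d%:E).
    rewrite lte_fin -ltrBrDl; near: q.
    by apply: (cvgr_lt (dot y p.1)) => //; rewrite ltrBrDl.
  by near: q; exact: fd.
near=> k.
have : b%:E <= dual (f_ k) (y_ k) + ((b - c) / 2)%:E.
  apply: le_trans (HB k _); last by near: k; exact: nbhs_infty_ge.
  apply: le_ereal_inf_tmp => _ [p Bp <-]; apply: ltW.
  exact: (near Bb k).
rewrite -leeBlDr//; apply: lt_le_trans.
by rewrite -EFinB lte_fin; lra.
Unshelve. all: by end_near. Qed.

(** * Concavity of the dual function and its local lower bounds *)

Lemma dotDl (R : realType) (m : nat) (y z u : 'rV[R]_m) :
  dot (y + z)%R u = (dot y u + dot z u)%R.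
Proof. by rewrite -big_split; apply: eq_bigr => i _; rewrite mxE mulrDl. Qed.

Lemma dotZl (R : realType) (m : nat) (a : R) (y u : 'rV[R]_m) :
  dot (a *: y)%R u = (a * dot y u)%R.
Proof. by rewrite [RHS]mulr_sumr; apply: eq_bigr => i _; rewrite mxE mulrA. Qed.

Lemma dot_delta (R : realType) (m : nat) (i : 'I_m) (u : 'rV[R]_m) :
  dot (delta_mx ord0 i) u = u ord0 i.
Proof.
rewrite /dot (bigD1 i)//= mxE !eqxx mul1r big1 ?addr0// => j /negPf ji.
by rewrite mxE ji andbF mul0r.
Qed.

(** A convex combination of two affine minorants of [f] is again one. Real lower bounds [b] and [c]
    avoid convex combinations of infinite values. *)
Lemma dual_concave (R : realType) (m n : nat)
    (f : 'rV[R]_m * 'rV[R]_n -> \bar R) (y z : 'rV[R]_m) (b c t : R) :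
  (0 <= t <= 1)%R -> b%:E <= dual f y -> c%:E <= dual f z ->
  ((1 - t) * b + t * c)%:E <= dual f ((1 - t) *: y + t *: z)%R.
Proof.
move=> /andP[t0 t1] /le_dualP fy /le_dualP fz; apply/le_dualP => p.
move: (fy p) (fz p); case: (f p) => [r||] //; last by rewrite !leey.
rewrite !lee_fin dotDl !dotZl => br cr; rewrite -subr_ge0 in t1.
have := ler_wpM2l t1 br; have := ler_wpM2l t0 cr; lra.
Qed.

(* With S = f p - M - <z, u>, the hypotheses give d |u_i| <= S for all i, and
   hence <v, u> <= sum_i |v_i| S / d <= S. *)
Lemma dual_ge_cross (R : realType) (m n : nat)
    (f : 'rV[R]_m * 'rV[R]_n -> \bar R) (z v : 'rV[R]_m) (M d : R) :
  (0 < d)%R -> M%:E <= dual f z ->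
  (forall i, M%:E <= dual f (z + d *: delta_mx ord0 i)%R) ->
  (forall i, M%:E <= dual f (z - d *: delta_mx ord0 i)%R) ->
  (\sum_(i < m) `|v ord0 i| <= d)%R -> M%:E <= dual f (z + v)%R.
Proof.
move=> d0 /le_dualP fz fzp fzm vd; apply/le_dualP => p; set u := p.1.
have fp i : (M + dot z u + d * u ord0 i)%:E <= f p.
  by have /le_dualP/(_ p) := fzp i; rewrite dotDl dotZl dot_delta addrA.
have fm i : (M + dot z u - d * u ord0 i)%:E <= f p.
  have /le_dualP/(_ p) := fzm i.
  by rewrite -scaleNr dotDl dotZl dot_delta addrA mulNr.
move: (fz p) fp fm; case: (f p) => [r| |]; [|by rewrite !leey|by rewrite leeNy_eq].
rewrite -/u lee_fin dotDl => Mr fp fm; rewrite lee_fin addrA.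
have S0 : (0 <= r - M - dot z u)%R by lra.
suff : (d * dot v u <= d * (r - M - dot z u))%R by rewrite ler_pM2l//; lra.
apply: le_trans (ler_wpM2r S0 vd); rewrite mulr_sumr mulr_suml.
apply: ler_sum => i _; rewrite mulrCA.
apply: le_trans (ler_norm _) _; rewrite normrM ler_wpM2l//.
rewrite ler_norml; have := fp i; have := fm i; rewrite !lee_fin; lra.
Qed.

Lemma dual_locally_bounded_below (R : realType) (m n : nat)
    (f : 'rV[R]_m * 'rV[R]_n -> \bar R) (z : 'rV[R]_m) :
  interior (edom (fun y => - dual f y)) z ->
  exists M : R, \forall w \near z, M%:E <= dual f w.
Proof.
move=> /nbhs_ballP[e /= e0 De].
have fin w : ball z e w -> exists c : R, c%:E <= dual f w.
  move=> /De; rewrite /edom/= lteNl => /lte_real_dense[c [_ /ltW cf]].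
  by exists c.
(* A radius strictly below [e] puts the vertices of the cross-polytope inside the open ball, where
   [dual f] has real lower bounds. *)
have [d d0 de] : exists2 d : R, (0 < d)%R & (d < e)%R.
  by exists (e / 2)%R; lra.
have ball_delta (s : R) i : (`|s| <= d)%R -> ball z e (z + s *: delta_mx ord0 i)%R.
  move=> sd; split=> // a j; rewrite /ball/= !mxE opprD addrA subrr sub0r normrN normrM.
  apply: le_lt_trans de; apply: le_trans sd.
  by rewrite ler_piMr//; case: (_ && _); rewrite ?normr1 ?normr0.
have [c0 fz] := fin z (ballxx z e0).
have /choice[cp fp] : forall i, exists c : R,
    c%:E <= dual f (z + d *: delta_mx ord0 i)%R.
  by move=> i; apply: fin; apply: ball_delta; rewrite gtr0_norm.
have /choice[cm fm] : forall i, exists c : R,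
    c%:E <= dual f (z - d *: delta_mx ord0 i)%R.
  move=> i; apply: fin; rewrite -scaleNr; apply: ball_delta.
  by rewrite normrN gtr0_norm.
(* A common lower bound for [c0] and all the [cp i] and [cm i], without taking a minimum. *)
pose M : R := (- (`|c0| + \sum_i (`|cp i| + `|cm i|)))%R.
have sum_ge0 (P : pred 'I_m) : (0 <= \sum_(i | P i) (`|cp i| + `|cm i|))%R.
  by apply: sumr_ge0 => i _; rewrite addr_ge0.
have Mc0 : (M <= c0)%R.
  by have := sum_ge0 xpredT; have := lerNnormlW (lexx `|c0|%R); rewrite /M; lra.
have Mcpm i : (M <= cp i)%R /\ (M <= cm i)%R.
  rewrite /M (bigD1 i)//=; have := sum_ge0 (predC1 i).
  have := lerNnormlW (lexx `|cp i|%R); have := lerNnormlW (lexx `|cm i|%R).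
  have := normr_ge0 c0; have := normr_ge0 (cp i); have := normr_ge0 (cm i).
  by rewrite /=; split; lra.
(* The ball is entrywise, so [m] entries below [d / m.+1] have absolute sum at most [d]; the
   successor keeps the denominator nonzero for [m = 0]. *)
have dm0 : (0 < d / m.+1%:R)%R by rewrite divr_gt0.
exists M; near=> w.
rewrite -[w](subrK z) addrC; apply: (@dual_ge_cross _ _ _ _ _ _ _ d) => //.
- by apply: le_trans fz; rewrite lee_fin.
- by move=> i; apply: le_trans (fp i); rewrite lee_fin; case: (Mcpm i).
- by move=> i; apply: le_trans (fm i); rewrite lee_fin; case: (Mcpm i).
have wz : ball z (d / m.+1%:R) w by near: w; exact: nbhsx_ballx.
apply: (@le_trans _ _ (\sum_(i < m) d / m.+1%:R)%R).
  apply: ler_sum => i _; have [_ /(_ ord0 i)] := wz.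
  by rewrite /ball/= distrC !mxE => /ltW.
rewrite sumr_const card_ord -[leLHS]mulr_natr -mulrA ler_piMr ?(ltW d0)//.
by rewrite mulrC ler_pdivrMr// mul1r ler_nat.
Unshelve. all: by end_near. Qed.

Lemma dual_approx_dense (R : realType) (m n : nat)
    (f : 'rV[R]_m * 'rV[R]_n -> \bar R) (Y : set 'rV[R]_m) (y : 'rV[R]_m)
    (c : R) (U : set 'rV[R]_m) :
  let D := edom (fun y => - dual f y) in
  interior D !=set0 -> D `<=` closure Y -> c%:E < dual f y -> nbhs y U ->
  exists w, [/\ Y w, U w & c%:E < dual f w].
Proof.
move=> D [z /dual_locally_bounded_below[M fM]] DY.
move=> /lte_real_dense[b []]; rewrite lte_fin => cb /ltW fb.
move=> /nbhs_interior yU.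
pose w_ (t : R) : 'rV[R]_m := ((1 - t) *: y + t *: z)%R.
pose b_ (t : R) := ((1 - t) * b + t * M)%R.
have id_cvg : (fun t : R => t) @ (0 : R)%R^'+ --> (0 : R)%R.
  exact: cvg_at_right_filter.
have onem_cvg : (fun t : R => 1 - t)%R @ (0 : R)%R^'+ --> (1 - 0 : R)%R.
  by apply: cvgB => //; exact: cvg_cst.
have w_cvg : w_ @ (0 : R)%R^'+ --> y.
  rewrite -[X in _ --> X]addr0 -[X in (X + _)%R]scale1r -[X in (_ + X)%R](scale0r z).
  rewrite -[X in (X *: y)%R](subr0 1%R).
  by apply: cvgD; apply: cvgZ => //; exact: cvg_cst.
have b_cvg : b_ @ (0 : R)%R^'+ --> b.
  rewrite -[X in _ --> X]addr0 -[X in (X + _)%R]mul1r -[X in (_ + X)%R](mul0r M).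
  rewrite -[X in (X * b)%R](subr0 1%R).
  by apply: cvgD; apply: cvgM => //; exact: cvg_cst.
(* For small positive [t], the point [w_ t] lies in the interior of [U], so [U] is a neighborhood of
   it, and the concavity bound [b_ t] is still above [c]. *)
have [t [t0 t1 Ut bt]] : exists t : R,
    [/\ (0 < t)%R, (t <= 1)%R, interior U (w_ t) & (c < b_ t)%R].
  suff : \forall t \near (0 : R)%R^'+,
      [/\ (0 < t)%R, (t <= 1)%R, interior U (w_ t) & (c < b_ t)%R].
    by move=> /filter_ex.
  near=> t; split; near: t.
  - exact: nbhs_right_gt.
  - by apply: nbhs_right_le.
  - exact: (w_cvg _ yU).
  - exact: (cvgr_gt b b_cvg _ cb).
have fw : \forall w \near w_ t, (b_ t)%:E <= dual f w.
  (* Solving [w = (1 - t) *: y + t *: z_ w] for the second endpoint: when [w] is near [w_ t], [z_ w]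
     is near [z], where [M] bounds [dual f] from below. *)
  pose z_ (w : 'rV[R]_m) := (t^-1 *: (w - (1 - t) *: y))%R.
  have z_cont : continuous z_.
    move=> w; have wc : (v - (1 - t) *: y)%R @[v --> w] --> (w - (1 - t) *: y)%R.
      exact: cvgB (@cvg_id _ (nbhs w)) (@cvg_cst _ _ _ (nbhs w) _).
    exact: (cvgZl_tmp (k := t^-1%R) wc).
  have zc : z_ w @[w --> w_ t] --> z.
    have -> : z = z_ (w_ t).
      by rewrite /z_ /w_ addrC addKr scalerA mulVf ?gt_eqF// scale1r.
    exact: z_cont.
  apply: (@filterS _ (nbhs (w_ t)) _ _ _ _ (zc _ fM)) => w /= fzw.
  have -> : w = ((1 - t) *: y + t *: z_ w)%R.
    by rewrite scalerA divff ?gt_eqF// scale1r addrC subrK.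
  by apply: dual_concave; rewrite ?(ltW t0).
have Dw : D (w_ t).
  rewrite /D/edom/= lteNl; apply: lt_le_trans (nbhs_singleton fw).
  exact: ltNyr.
have [w [Yw [Uw bw]]] := DY _ Dw _ (filterI Ut fw).
by exists w; split => //; apply: lt_le_trans bw; rewrite lte_fin.
Unshelve. all: by end_near. Qed.

(** * Hypo-convergence of the dual functions *)

(** The upper condition follows from epi-convergence alone, so both claims reduce to finding good
    sequences at points where [dual f] is not [-oo]. *)
Lemma hypo_converges_dual (R : realType) (m n : nat)
    (f_ : nat -> 'rV[R]_m * 'rV[R]_n -> \bar R)
    (f : 'rV[R]_m * 'rV[R]_n -> \bar R) :
  epi_converges f_ f ->
  (forall y, -oo < dual f y -> exists2 y_ : nat -> 'rV[R]_m, y_ @ \oo --> y &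
     forall c : R, c%:E < dual f y ->
       \forall k \near \oo, c%:E < dual (f_ k) (y_ k)) ->
  hypo_converges (fun k => dual (f_ k)) (dual f).
Proof.
move=> f_epi f_inf; split=> [y y_ yy|y].
  apply/le_limn_einfP => c; rewrite lteNr -EFinN => fc.
  apply: filterS (dual_lt_near f_epi yy fc) => k.
  by rewrite lteNr -EFinN.
(* Where [dual f y] is [-oo], the required upper bound is [+oo] and the constant sequence does. *)
have [fy|] := boolP (-oo < dual f y); last first.
  rewrite ltNye negbK => /eqP ->; exists (fun=> y); first exact: cvg_cst.
  by rewrite leey.
have [y_ yy fc] := f_inf _ fy; exists y_ => //.
apply/limn_esup_leP => c; rewrite lteNl -EFinN => /fc.
by apply: filterS => k; rewrite lteNl -EFinN.
Qed.

Unset Implicit Arguments.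
Set Strict Implicit.

Theorem theorem5p1 (R : realType) (m n : nat)
    (f : 'rV[R]_m * 'rV[R]_n -> \bar R)
    (f_ : nat -> 'rV[R]_m * 'rV[R]_n -> \bar R)
    (phi : 'rV[R]_n -> \bar R) (phi_ : nat -> 'rV[R]_n -> \bar R)
    (f_phi : Rockafellian f phi)
    (f_phi_ : forall k, Rockafellian (f_ k) (phi_ k))
    (f_epi : epi_converges f_ f) :
  let D := edom (fun y => - dual f y) in
  ((forall y, D y -> exists2 y_ : nat -> 'rV[R]_m,
       y_ @ \oo --> y & tight (fun k => tilt (f_ k) (y_ k))) ->
     hypo_converges (fun k => dual (f_ k)) (dual f) /\
     (forall (y : 'rV[R]_m) (y_ : nat -> 'rV[R]_m), D y ->
        y_ @ \oo --> y -> tight (fun k => tilt (f_ k) (y_ k)) ->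
        (fun k => dual (f_ k) (y_ k)) @ \oo --> dual f y)) /\
  (forall Y : set 'rV[R]_m,
     interior D !=set0 -> Y `<=` D -> D `<=` closure Y ->
     (forall y, Y y -> tight (fun k => tilt (f_ k) y)) ->
     hypo_converges (fun k => dual (f_ k)) (dual f)).
Proof.
move=> D.
have DE y : D y = (-oo < dual f y) by rewrite /D/edom/= lteNl.
split=> [tightD|Y intD YD DY tightY].
  split=> [|y y_ _ yy ty].
    apply: hypo_converges_dual => // y; rewrite -DE => /tightD[y_ yy ty].
    by exists y_ => // c; exact: tight_dual_gt_near.
  apply: cvg_ereal_squeeze => c; first exact: dual_lt_near.
  exact: tight_dual_gt_near.
apply: hypo_converges_dual => // y /real_approx_below[a [a_mono a_lt a_sup]].
(* Level [j] asks for distance below [1 / (j + 1)] from [y] and a dual value above [a j]; a diagonal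
   sequence meets every level eventually. *)
pose P j k w := ball y j.+1%:R^-1 w /\ (a j)%:E < dual (f_ k) w.
have [i j k w ij [yw aw]|j|y_ Py] := @diagonal_sequence _ y P.
- split; first by apply: le_ball yw; rewrite lef_pV2 ?posrE// ler_nat.
  by apply: le_lt_trans aw; rewrite lee_fin a_mono.
(* One point [w] of [Y] serves all large [k] at level [j]: tightness at [w] is applied along the
   constant sequence. *)
- have [|w [Yw yw aw]] :=
      dual_approx_dense intD DY (a_lt j) (nbhsx_ballx y (j.+1%:R^-1)%R _).
    by rewrite invr_gt0.
  apply: filterS (tight_dual_gt_near f_epi (cvg_cst w) (tightY _ Yw) aw) => k.
  by exists w.
exists y_.
  apply/cvg_ballP => e e0.
  have [J _ HJ] := near_infty_natSinv_lt (PosNum e0).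
  apply: filterS (Py J) => k [yk _]; apply: le_ball yk.
  exact/ltW/(HJ J (leqnn J)).
move=> c /a_sup[j caj]; apply: filterS (Py j) => k [_].
by apply: le_lt_trans; rewrite lee_fin.
Qed.
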